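(* Let $H\in C^2(\mathbb R^d\times\mathbb R^d;\mathbb R)$, $H=H(p,x)$, be $\mathbb Z^d$-periodic in $x$, with $D^2_{pp}H>0$ and $\lim_{|p|\to+\infty}|p|^{-1}H(p,x)=+\infty$ uniformly in $x$. Let $f:\mathbb R^d\to\mathbb R$ be nonnegative, bounded, uniformly continuous and almost periodic. Let $\overline H$ be the effective constant of $H$ and $\overline H_f$ the ergodic constant of $H_f(p,x)=H(p,x)-f(x)$, and set $$\hat f(x)=\limsup_{N\to+\infty}N^{-d}\sum_{k\in\mathbb Z^d,\;Q_1(k)\subset Q_N}f(x+k),\qquad x\in\mathbb R^d .$$ Then $$0\le\overline H-\overline H_f\le\|\hat f\|_\infty .$$
   Context: Hamilton-Jacobi equations are understood in the viscosity sense. For $R>0$, $Q_R(x)=x+[-R/2,R/2)^d$ and $Q_R=Q_R(0)$. $N$ ranges over the positive integers. $\overline H$ is the unique constant for which $H(D\chi,x)=\overline H$ in $\mathbb R^d$ has a continuous $\mathbb Z^d$-periodic solution $\chi$. $\overline H_f$ is the uniform limit on $\mathbb R^d$, as $\delta\to0$, of $-\delta v^\delta$, where $v^\delta$ is the unique bounded solution of $\delta v^\delta+H_f(Dv^\delta,x)=0$ in $\mathbb R^d$. *)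

(* Defs.v *)
From HB Require Import structures.
From mathcomp Require Import all_boot all_order all_algebra.
From mathcomp Require Import all_classical all_reals all_analysis.

Set Implicit Arguments.
Unset Strict Implicit.
Unset Printing Implicit Defensive.
Import Order.TTheory GRing.Theory Num.Theory.
Import numFieldNormedType.Exports.

Local Open Scope classical_set_scope.
Local Open Scope ring_scope.

(* The space R^d is 'rV[R]_d.  Its library norm `|x| is the max norm; the
   notions below that mention it do not depend on the choice of the norm. *)

Section differential_calculus.
Context {R : realType}.

(* In finite dimension, continuity of x |-> 'd g x amounts to continuity of
   x |-> 'd g x v for every v. *)
Definition C1 (V : normedModType R) (g : V -> R) : Prop :=
  (forall x, differentiable g x) /\
  forall v, continuous (fun x => 'd g x v : R).

Definition C2 (V : normedModType R) (g : V -> R) : Prop :=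
  C1 g /\ forall v, C1 (fun x => 'd g x v : R).

Variable d : nat.
Implicit Types (g : 'rV[R]_d -> R) (x : 'rV[R]_d).

Definition grad g x : 'rV[R]_d := \row_i 'D_(delta_mx 0 i) g x.

Definition hessian g x : 'M[R]_d :=
  \matrix_(i, j) 'D_(delta_mx 0 j) ('D_(delta_mx 0 i) g) x.

(* Only applied to Hessians of C2 functions, which are symmetric. *)
Definition posdef_mx (A : 'M[R]_d) : Prop :=
  forall q : 'rV[R]_d, q != 0 -> 0 < (q *m A *m q^T) 0 0.

End differential_calculus.

Section functions_on_Rd.
Context {R : realType} {d : nat}.
Implicit Types (g : 'rV[R]_d -> R).

Definition Zd_periodic g : Prop :=
  forall (x : 'rV[R]_d) (k : 'rV[int]_d), g (x + map_mx intr k) = g x.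

(* Bohr's definition: for every eps > 0, the eps-almost periods of g are
   relatively dense. *)
Definition almost_periodic g : Prop :=
  forall eps : R, 0 < eps -> exists L : R, forall y : 'rV[R]_d,
    exists2 t : 'rV[R]_d, `|t - y| <= L &
      forall x, `|g (x + t) - g x| <= eps.

Definition sup_norm g : R := sup (range (fun x => `|g x|)).

Definition cube (r : R) (x : 'rV[R]_d) : set 'rV[R]_d :=
  [set y | forall i, x 0 i - r / 2 <= y 0 i < x 0 i + r / 2].

(* The index set of the sum is finite.  The term N = 0 plays no role in the
   limit superior. *)
Definition hat g (x : 'rV[R]_d) : R :=
  limn_sup (fun N : nat => N%:R ^- d *
    \sum_(k \in [set k : 'rV[int]_d |
                  cube 1 (map_mx intr k) `<=` cube N%:R 0])
      g (x + map_mx intr k)).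

End functions_on_Rd.

Section hamilton_jacobi.
Context {R : realType} {d : nat}.
Implicit Types (F : R -> 'rV[R]_d -> 'rV[R]_d -> R).
Implicit Types (H : 'rV[R]_d -> 'rV[R]_d -> R) (u : 'rV[R]_d -> R).

Definition superlinear H : Prop :=
  forall A : R, exists B : R, forall p x : 'rV[R]_d,
    B < `|p| -> A <= `|p|^-1 * H p x.

(* F r p x stands for the equation F(u, Du, x) = 0 in R^d. *)
Definition viscosity_subsolution F u : Prop :=
  forall (phi : 'rV[R]_d -> R) (x : 'rV[R]_d), C1 phi ->
    (\forall y \near x, u y - phi y <= u x - phi x) ->
    F (u x) (grad phi x) x <= 0.

Definition viscosity_supersolution F u : Prop :=
  forall (phi : 'rV[R]_d -> R) (x : 'rV[R]_d), C1 phi ->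
    (\forall y \near x, u x - phi x <= u y - phi y) ->
    0 <= F (u x) (grad phi x) x.

Definition viscosity_solution F u : Prop :=
  [/\ continuous u, viscosity_subsolution F u & viscosity_supersolution F u].

(* Uniqueness of c, and uniqueness of v delta in the next definition, are
   theorems for the Hamiltonians of interest; they are not required here. *)
Definition effective_constant H (c : R) : Prop :=
  exists chi : 'rV[R]_d -> R,
    Zd_periodic chi /\ viscosity_solution (fun _ p x => H p x - c) chi.

Definition ergodic_constant H (c : R) : Prop :=
  exists v : R -> 'rV[R]_d -> R,
    (forall delta, 0 < delta ->
       [bounded v delta x | x in setT] /\
       viscosity_solution (fun r p x => delta * r + H p x) (v delta)) /\
    (forall eps : R, 0 < eps -> \forall delta \near 0^'+,
       forall x, `|- delta * v delta x - c| < eps).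

End hamilton_jacobi.

(* Main.v *)
(* Both inequalities are comparisons between the periodic corrector and v^delta.
   Since f >= 0, chi - C - Hbar / delta is a subsolution of the equation of
   v^delta, whence Hbarf <= Hbar.  For the other bound, average v^delta over the
   lattice translates v^delta(. + k), k in a large cube.  As H is periodic in x
   and convex in p, the average is a subsolution of
   delta u + H(Du, x) <= (lattice average of f), and by almost periodicity the
   right-hand side is eventually below ||hat f|| + eps uniformly in x; compare
   with chi + C + (||hat f|| + eps - Hbar) / delta.
   Both the averaging and the comparison come out of one maximization in which
   the variable of each translate is doubled on its own, against the single
   variable of the supersolution: at the maximum the slope of the supersolution
   is the mean of those of the translates, up to a small error, and the slopes
   are bounded by coercivity. *)
Require Import Defs.
From HB Require Import structures.
From mathcomp Require Import all_boot all_order all_algebra.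
From mathcomp Require Import all_classical all_reals all_analysis.
From mathcomp Require Import ring lra zify.

Set Implicit Arguments.
Unset Strict Implicit.
Unset Printing Implicit Defensive.
Import Order.TTheory GRing.Theory Num.Theory.
Import numFieldNormedType.Exports.

Local Open Scope classical_set_scope.
Local Open Scope ring_scope.

(** * Boundedness and uniform continuity from compactness and periodicity *)

Section compactness.
Context {R : realType}.

(** Heine-Cantor with only one of the two points confined to [K]: near-covering compactness turns
    the radius found around each point into a common one. *)
Lemma compact_unif_continuous (V : normedModType R) (g : V -> R) (K : set V)
    (e : R) :
  compact K -> continuous g -> 0 < e ->
  exists2 r : R, 0 < r &
    forall x y, K x -> `|x - y| < r -> `|g x - g y| < e.
Proof.
move=> /compact_near_coveringP Kc gc e0.
have := Kc R (0^'+) (fun r x => forall y, `|x - y| < r -> `|g x - g y| < e) _.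
case=> [x Kx|r /= r0 rP].
  have e20 : 0 < e / 2 by rewrite divr_gt0.
  have /cvgrPdist_lt/(_ _ e20)/nbhs_ballP[s /= s0 sP] := gc x.
  have s20 : 0 < s / 2 by rewrite divr_gt0.
  exists (ball x (s / 2), [set r | r < s / 2]) => /=.
    by split; [exact: nbhsx_ballx | exact: nbhs_right_lt].
  move=> [x' r] /= [xx' rs] y xy.
  have gx' : `|g x - g x'| < e / 2.
    apply: sP; apply: le_ball xx'.
    by rewrite ler_pdivrMr// ler_peMr ?ler1n ?ltW.
  have gy : `|g x - g y| < e / 2.
    apply: sP; rewrite -ball_normE /= (splitr s).
    rewrite -[x - y](subrKA x') (le_lt_trans (ler_normD _ _))//.
    move: xx'; rewrite -ball_normE /= => xx'.
    by rewrite ltrD// (lt_trans xy).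
  rewrite -[_ - _](subrKA (g x)) (le_lt_trans (ler_normD _ _))//.
  by rewrite (splitr e) ltrD// distrC.
exists (r / 2); first by rewrite divr_gt0.
move=> x y Kx xy; apply: (rP (r / 2)) => //=.
- by rewrite sub0r normrN gtr0_norm ?divr_gt0// ltr_pdivrMr// ltr_pMr// ltr1n.
- by rewrite divr_gt0.
Qed.

Lemma compact_norm_le d (B : R) : compact [set x : 'rV[R]_d | `|x| <= B].
Proof.
apply: bounded_closed_compact.
  exists B; split => [|M BM x /= xB]; first by rewrite num_real.
  by rewrite (le_trans xB)// ltW.
by apply: (@preimage_closed _ _ _ [set x : R | x <= B]) => [x _|];
  [exact: norm_continuous|exact: closed_le].
Qed.

Lemma row_norm_le d (x : 'rV[R]_d) (B : R) :
  0 <= B -> (forall i, `|x 0 i| <= B) -> `|x| <= B.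
Proof.
move=> B0 xB; rewrite [leLHS]/Num.norm /= mx_normrE; apply/bigmax_leP.
by split => // -[i j] _ /=; rewrite ord1.
Qed.

Lemma lattice_translate d (x : 'rV[R]_d) :
  exists k : 'rV[int]_d, `|x + map_mx intr k| <= 1.
Proof.
exists (\row_i - Num.floor (x 0 i)); apply: row_norm_le => // i.
rewrite !mxE rmorphN /= ger0_norm ?subr_ge0 ?Num.Theory.floor_le//.
by rewrite lerBlDl ltW// -intrD1 floorD1_gt.
Qed.

Lemma periodic_bounded d (g : 'rV[R]_d -> R) :
  continuous g -> Zd_periodic g -> exists C : R, forall x, `|g x| <= C.
Proof.
move=> gc gp.
have [|C [_ Cg]] := @compact_bounded _ _ (g @` [set x : 'rV[R]_d | `|x| <= 1]).
  apply: continuous_compact; last exact: compact_norm_le.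
  exact: continuous_subspaceT.
exists (C + 1) => x; have [k xk] := lattice_translate x.
by rewrite -(gp x k); apply: Cg; [rewrite ltrDl | exists (x + map_mx intr k)].
Qed.

(** One lattice vector moves [x] into the unit ball and is applied to [y] as well, so it is enough
    to use compactness for [p] bounded by [B] and [x] in that ball. *)
Lemma periodic_unif_continuous d (H : 'rV[R]_d -> 'rV[R]_d -> R) (B e : R) :
  continuous (fun z : 'rV[R]_d * 'rV[R]_d => H z.1 z.2) ->
  (forall p, Zd_periodic (H p)) -> 0 < e ->
  exists2 r : R, 0 < r & forall p q x y, `|p| <= B -> `|p - q| < r ->
    `|x - y| < r -> `|H p x - H q y| < e.
Proof.
move=> Hc Hp e0.
have KK := compact_setX (@compact_norm_le d B) (@compact_norm_le d 1).
have [r r0 rP] := compact_unif_continuous KK Hc e0.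
exists r => // p q x y pB pq xy; have [k xk] := lattice_translate x.
rewrite -(Hp p x k) -(Hp q y k).
apply: (rP (p, x + map_mx intr k) (q, y + map_mx intr k)) => //.
by rewrite prod_normE gt_max /= pq opprD addrACA subrr addr0.
Qed.

End compactness.

Lemma sum_continuous (R : realType) (T : topologicalType) (I : finType)
    (g : I -> T -> R) :
  (forall i, continuous (g i)) -> continuous (fun t => \sum_i g i t).
Proof.
by move=> gc t; apply: cvg_big => [|i _]; [exact: add_continuous|exact: gc].
Qed.

(** * Quadratic test functions and their gradients *)

Section quadratic_test_functions.
Context {R : realType} {d : nat}.
Implicit Types (l v x y : 'rV[R]_d) (u : 'rV[R]_d -> R).

(** Squared Euclidean norm: penalties must be smooth, which the max norm is not. *)
Definition sqn x : R := \sum_j x 0 j ^+ 2.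

(** Polynomials with isotropic Hessian: up to constants the class contains all penalties and is
    stable under sums, multiples and translations. *)
Definition quad (c : R) l x : R := \sum_j (c * x 0 j ^+ 2 + l 0 j * x 0 j).

Lemma is_derive_coord (j : 'I_d) x v :
  is_derive x v (fun y : 'rV[R]_d => y 0 j) (v 0 j).
Proof.
have dj := @differentiable_coord R 1 d x 0 j.
apply: DeriveDef; first exact: diff_derivable.
have @f : {linear 'rV[R]_d -> R}.
  by exists (fun y : 'rV[R]_d => y 0 j); do 2![eexists]; do ?[constructor];
     rewrite ?mxE// => ? *; rewrite ?mxE//; move=> ?; rewrite !mxE.
rewrite deriveE// (_ : (fun _ => _) = f)// diff_lin//.
exact: coord_continuous.
Qed.

Lemma is_derive_quad c l x v :
  is_derive x v (quad c l) (\sum_j ((2 * c * x 0 j + l 0 j) * v 0 j)).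
Proof.
have -> : quad c l =
    \sum_j (fun y : 'rV[R]_d => c * y 0 j ^+ 2 + l 0 j * y 0 j).
  by apply/funext => y; rewrite fct_sumE.
apply: is_derive_sum => j; have dj := is_derive_coord j x v.
apply: is_derive_eq; rewrite /GRing.scale /=; ring.
Qed.

Lemma differentiable_quad c l x : differentiable (quad c l) x.
Proof.
have -> : quad c l =
    \sum_j (fun y : 'rV[R]_d => c * y 0 j ^+ 2 + l 0 j * y 0 j).
  by apply/funext => y; rewrite fct_sumE.
apply: differentiable_sum => j; have dj := @differentiable_coord R 1 d x 0 j.
apply: differentiableD; apply: differentiableZ => //.
by rewrite (_ : (fun _ => _) = (fun y : 'rV[R]_d => y 0 j) ^+ 2);
  [exact: differentiableX | apply/funext => y; rewrite exprfctE].
Qed.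

Lemma quad_continuous c l : continuous (quad c l).
Proof.
by move=> x; apply: differentiable_continuous; exact: differentiable_quad.
Qed.

Lemma C1_quad c l : C1 (quad c l).
Proof.
split=> [x|v]; first exact: differentiable_quad.
(* The directional derivative is affine in the point, hence a [quad] with leading coefficient 0 plus
   a constant. *)
have -> : (fun x => 'd (quad c l) x v : R) =
    (fun x => quad 0 ((2 * c) *: v) x + \sum_j l 0 j * v 0 j).
  apply/funext => x; rewrite -deriveE; last exact: differentiable_quad.
  rewrite (@derive_val _ _ _ _ _ _ _ (is_derive_quad c l x v)) -big_split /=.
  by apply: eq_bigr => j _; rewrite !mxE; ring.
move=> x; apply: (@cvgD _ _ _ (nbhs x)); last exact: cvg_cst.
exact: quad_continuous.
Qed.

Lemma grad_quad c l x : grad (quad c l) x = (2 * c) *: x + l.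
Proof.
apply/rowP => i; rewrite !mxE.
rewrite (@derive_val _ _ _ _ _ _ _ (is_derive_quad c l x _)).
rewrite (bigD1 i)//= mxE !eqxx mulr1 big1 ?addr0// => j ji.
by rewrite mxE (negbTE ji) andbF mulr0.
Qed.

Lemma sqnB_quad c x y : c * sqn (x - y) = quad c (- (2 * c) *: y) x + c * sqn y.
Proof.
rewrite /sqn /quad !mulr_sumr -big_split /=; apply: eq_bigr => j _.
by rewrite !mxE; ring.
Qed.

Lemma sqn_opp x : sqn (- x) = sqn x.
Proof. by apply: eq_bigr => j _; rewrite mxE sqrrN. Qed.

Lemma quadD b c k l x : quad b k x + quad c l x = quad (b + c) (k + l) x.
Proof.
by rewrite /quad -big_split /=; apply: eq_bigr => j _; rewrite mxE; ring.
Qed.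

Lemma quad_sum (I : finType) (F : I -> R * 'rV[R]_d) x :
  \sum_i quad (F i).1 (F i).2 x = quad (\sum_i (F i).1) (\sum_i (F i).2) x.
Proof.
rewrite exchange_big; apply: eq_bigr => j _.
by rewrite big_split /= summxE !mulr_suml.
Qed.

Lemma quadZ k c l x : k * quad c l x = quad (k * c) (k *: l) x.
Proof.
by rewrite /quad mulr_sumr; apply: eq_bigr => j _; rewrite mxE; ring.
Qed.

Lemma quad_translate c l a x :
  quad c l (x - a) = quad c (l - (2 * c) *: a) x + quad c l (- a).
Proof.
rewrite /quad -big_split /=; apply: eq_bigr => j _.
by rewrite !mxE; ring.
Qed.

Lemma sqn_ge0 x : 0 <= sqn x.
Proof. by apply: sumr_ge0 => j _; exact: sqr_ge0. Qed.

Lemma sqrnorm_le_sqn x : `|x| ^+ 2 <= sqn x.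
Proof.
have -> : sqn x = Num.sqrt (sqn x) ^+ 2 by rewrite sqr_sqrtr// sqn_ge0.
rewrite ler_sqr ?nnegrE ?sqrtr_ge0//.
apply: row_norm_le => [|i]; first exact: sqrtr_ge0.
rewrite -sqrtr_sqr ler_wsqrtr// /sqn (bigD1 i)//= lerDl.
by apply: sumr_ge0 => j _; exact: sqr_ge0.
Qed.

Lemma sqn_continuous : continuous sqn.
Proof.
have -> : sqn = quad 1 0 by apply/funext => x;
  apply: eq_bigr => j _; rewrite mxE; ring.
exact: quad_continuous.
Qed.

End quadratic_test_functions.

(** * Viscosity inequalities tested against quadratics *)

Section quadratic_solutions.
Context {R : realType} {d : nat}.
Implicit Types (F : R -> 'rV[R]_d -> 'rV[R]_d -> R) (u : 'rV[R]_d -> R).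

(* Only global extrema against quadratic test functions are ever tested. *)
Definition quad_subsolution F u : Prop := forall c l x,
  (forall y, u y - quad c l y <= u x - quad c l x) ->
  F (u x) ((2 * c) *: x + l) x <= 0.

Definition quad_supersolution F u : Prop := forall c l x,
  (forall y, u x - quad c l x <= u y - quad c l y) ->
  0 <= F (u x) ((2 * c) *: x + l) x.

Lemma viscosity_quad_subsolution F u :
  viscosity_subsolution F u -> quad_subsolution F u.
Proof.
move=> uF c l x ux; rewrite -grad_quad; apply: uF; first exact: C1_quad.
by apply: (@filterE _ (nbhs x)) => y; exact: ux.
Qed.

Lemma viscosity_quad_supersolution F u :
  viscosity_supersolution F u -> quad_supersolution F u.
Proof.
move=> uF c l x ux; rewrite -grad_quad; apply: uF; first exact: C1_quad.
by apply: (@filterE _ (nbhs x)) => y; exact: ux.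
Qed.

Lemma quad_subsolution_translate F u (a : 'rV[R]_d) : quad_subsolution F u ->
  quad_subsolution (fun r p x => F r p (x + a)) (fun x => u (x + a)).
Proof.
(* The slope of the test function at [x] is that of its translate at [x + a], and the translate is
   again a [quad] up to a constant. *)
move=> uF c l x ux; have -> : (2 * c) *: x + l =
    (2 * c) *: (x + a) + (l - (2 * c) *: a).
  by rewrite scalerDr addrACA subrr addr0.
apply: uF => y; have := ux (y - a).
rewrite subrK quad_translate -[in leRHS](addrK a x) quad_translate.
by rewrite subrK !opprD !addrA lerD2r.
Qed.

End quadratic_solutions.

(** * Comparison of a mean of subsolutions with a supersolution *)

Section comparison_principle.
Context {R : realType} {d : nat} (I : finType).
Implicit Types (u : I -> 'rV[R]_d -> R) (w : 'rV[R]_d -> R).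

(** Continuity gives a maximum on a compact product of balls; outside it the penalty outweighs
    whatever functions bounded by [C] can gain over the configuration with all variables at [z]. *)
Lemma penalized_max u w (a b C : R) (z : 'rV[R]_d) (i0 : I) :
  0 < a -> 0 < b ->
  (forall i, continuous (u i)) -> continuous w ->
  (forall i x, `|u i x| <= C) -> (forall x, `|w x| <= C) ->
  let Phi (X : I -> 'rV[R]_d) (y : 'rV[R]_d) :=
    \sum_i (u i (X i) - a * sqn (X i - y) - w y - b * sqn (y - z)) in
  exists X y, forall X' y', Phi X' y' <= Phi X y.
Proof.
move=> a0 b0 uc wc uC wC Phi.
have C0 : 0 <= C by exact: le_trans (wC z).
(* All variables form one point of a product space, where Tychonoff applies: [None] indexes [y] and
   [Some i] indexes [X i]. *)
pose T := prod_topology (fun _ : option I => 'rV[R]_d).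
pose Psi (f : T) := Phi (f \o Some) (f None).
have Psic : continuous Psi.
  apply: sum_continuous => i f.
  have pc o : continuous (fun f : T => f o) by exact: proj_continuous.
  have diffc o (y : 'rV[R]_d) : continuous (fun f : T => sqn (f o - y)).
    move=> g; apply: (@continuous_comp _ _ _ (fun f : T => f o - y) sqn);
      last exact: sqn_continuous.
    by apply: (@cvgB _ _ _ (nbhs g)); [exact: pc|exact: cvg_cst].
  have pairc o o' : continuous (fun f : T => sqn (f o - f o')).
    move=> g; apply: (@continuous_comp _ _ _ (fun f : T => f o - f o') sqn);
      last exact: sqn_continuous.
    by apply: (@cvgB _ _ _ (nbhs g)); exact: pc.
  apply: (@cvgB _ _ _ (nbhs f)); last first.
    apply: (@cvgM _ _ (nbhs f)); [exact: cvg_cst|exact: diffc].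
  apply: (@cvgB _ _ _ (nbhs f)); last first.
    apply: (@continuous_comp _ _ _ (fun f : T => f None) w); first exact: pc.
    exact: wc.
  apply: (@cvgB _ _ _ (nbhs f)).
    apply: (@continuous_comp _ _ _ (fun f : T => f (Some i)) (u i)).
      exact: pc.
    exact: uc.
  by apply: (@cvgM _ _ (nbhs f)); [exact: cvg_cst|exact: pairc].
pose m : R := #|I|%:R; pose c := Num.min a b.
have m0 : 0 < m by rewrite ltr0n; apply/card_gt0P; exists i0.
have c0 : 0 < c by rewrite lt_min a0.
(* Chosen so that [4 * C * m <= c * r ^+ 2]: with all variables at [z] the sum is at least
   [- (2 * C * m)], and without penalties it never exceeds [2 * C * m]. *)
pose r := 1 + 4 * C * m / c.
have r1 : 1 <= r by rewrite lerDl divr_ge0 ?mulr_ge0// ltW.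
have r0 : 0 < r by exact: lt_le_trans r1.
have cr : 4 * C * m <= c * r ^+ 2.
  rewrite (le_trans (_ : _ <= c * r))//.
    by rewrite /r mulrDr mulr1 mulrCA divff ?mulr1 ?gt_eqF// lerDr ltW.
  by rewrite ler_pM2l// expr2 ler_peMl// ltW.
pose K : set T := [set f | forall o, `|f o| <= `|z| + 2 * r].
have Kc : compact K.
  apply: (@tychonoff _ _ (fun=> [set x | `|x| <= `|z| + 2 * r])) => k.
  exact: compact_norm_le.
have Kz : K (fun=> z) by move=> o; rewrite lerDl mulr_ge0// ltW.
have [| |f fK fmax] := @compact_EVT_max _ _ Psi K _ Kc.
- by exists (fun=> z).
- exact: continuous_subspaceT.
exists (f \o Some), (f None) => X' y'.
pose f' : T := fun o => if o is Some i then X' i else y'.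
rewrite -/(Psi f) -[leLHS]/(Psi f').
have [Kf'|] := pselect (K f'); first exact/fmax/mem_set.
(* Outside [K] some variable is farther than [2 * r] from [z], so either [y'] is at least [r] away
   from [z], or some [X' i] is at least [r] away from [y']. *)
move=> /existsNP[k /negP].
rewrite -ltNge => zk.
have {}zk : 2 * r < `|f' k - z|.
  rewrite -(ltrD2r `|z|) addrC (lt_le_trans zk)//.
  by rewrite -[in leLHS](subrK z (f' k)) ler_normD.
apply: le_trans (fmax _ (mem_set Kz)).
have sq_large (e : R) (x : 'rV[R]_d) : 0 < e -> c <= e -> r <= `|x| ->
    4 * C * m <= e * sqn x.
  move=> e0 ce rx; rewrite (le_trans cr)// ler_pM ?sqr_ge0 ?(ltW c0)//.
  by rewrite (le_trans _ (sqrnorm_le_sqn x))// ler_sqr ?nnegrE// ltW.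
(* The penalty of the single index [i] outweighs the bounded part of the sum. *)
have [i hi] : exists i, 4 * C * m <= a * sqn (X' i - y') + b * sqn (y' - z).
  have [ry|yr] := leP r `|y' - z|.
    exists i0; rewrite (le_trans (sq_large b _ _ _ ry))// ?ge_min ?lexx ?orbT//.
    by rewrite lerDr mulr_ge0 ?sqn_ge0// ltW.
  case: k zk => [i /= zi|/= yz]; last first.
    by move: (lt_trans yz yr); rewrite gtr_pMl// ltNge ler1n.
  exists i; rewrite (le_trans (sq_large a (X' i - y') _ _ _))// ?ge_min ?lexx//.
    rewrite -(lerD2r `|y' - z|) (le_trans (_ : _ <= 2 * r))//.
      by rewrite mulr2n mulrDl mul1r lerD2l ltW.
    rewrite (le_trans (ltW zi))// -[X' i - z](subrKA y').
    exact: ler_normD.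
  by rewrite lerDl mulr_ge0 ?sqn_ge0// ltW.
have -> : Psi (fun=> z) = \sum_i (u i z - w z).
  apply: eq_bigr => j _; rewrite /= !subrr.
  have -> : sqn (0 : 'rV[R]_d) = 0.
    by rewrite /sqn big1// => l _; rewrite mxE expr0n.
  by rewrite !mulr0 !subr0.
pose e j := a * sqn (X' j - y') + b * sqn (y' - z).
have e0 j : 0 <= e j by rewrite addr_ge0// mulr_ge0 ?sqn_ge0// ltW.
rewrite (le_trans (_ : _ <= \sum_j (2 * C - e j)))//.
  apply: ler_sum => j _; move: (uC j (X' j)) (wC y'); rewrite !ler_norml /e /=.
  by move=> /andP[? ?] /andP[? ?]; lra.
rewrite (le_trans (_ : _ <= \sum_(j : I) (- (2 * C))))//; last first.
  apply: ler_sum => j _; move: (uC j z) (wC z); rewrite !ler_norml.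
  by move=> /andP[? ?] /andP[? ?]; lra.
rewrite sumrB !sumr_const.
rewrite -[(- _) *+ _]mulr_natl -[(2 * C) *+ _]mulr_natl -/m.
have : 4 * C * m <= \sum_j e j.
  by rewrite (le_trans hi)// (bigD1 i)//= lerDl sumr_ge0.
lra.
Qed.

(** A positive excess [s] at [z] is refuted at a penalized maximum: the inequalities of the [u i],
    moved to the common point [y] and summed, contradict that of [w]. Convexity enters only as
    Jensen's inequality for means over [I]. *)
Lemma comparison (H : 'rV[R]_d -> 'rV[R]_d -> R) (g : I -> 'rV[R]_d -> R)
    (G : 'rV[R]_d -> R) u w (delta C : R) :
  (0 < #|I|)%N -> 0 < delta ->
  continuous (fun z : 'rV[R]_d * 'rV[R]_d => H z.1 z.2) ->
  (forall p, Zd_periodic (H p)) -> superlinear H ->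
  (forall x (p : I -> 'rV[R]_d),
     #|I|%:R * H (#|I|%:R^-1 *: \sum_i p i) x <= \sum_i H (p i) x) ->
  (forall i, continuous (u i)) -> continuous w ->
  (forall i x, `|u i x| <= C) -> (forall x, `|w x| <= C) ->
  (forall i x, g i x <= C) ->
  (forall e, 0 < e -> exists2 r, 0 < r &
     forall i x y, `|x - y| < r -> `|g i x - g i y| < e) ->
  (forall i,
     quad_subsolution (fun r p x => delta * r + H p x - g i x) (u i)) ->
  quad_supersolution (fun r p x => delta * r + H p x - G x) w ->
  (forall x, \sum_i g i x <= #|I|%:R * G x) ->
  forall x, \sum_i u i x <= #|I|%:R * w x.
Proof.
move=> I0 delta0 Hc Hper Hsup Hconv uc wc uC wC gC guc usub wsup gG z.
have [i0 _] := card_gt0P I0.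
rewrite leNgt; apply/negP => uw.
pose m : R := #|I|%:R; have m0 : 0 < m by rewrite ltr0n.
pose s := \sum_i u i z - m * w z; have s0 : 0 < s by rewrite subr_gt0.
(* Each index costs three errors of at most [k]: moving [H], moving [g i], and removing [e] from the
   slope. As [4 * (m * k) = delta * s], they total less than [delta * s]. *)
pose k := delta * s / (4 * m).
have k0 : 0 < k by rewrite divr_gt0 ?mulr_gt0.
have C0 : 0 <= C by exact: le_trans (wC z).
(* Beyond [B], superlinearity with constant 1 makes [H p x] at least the norm of [p]. The
   subsolution inequality bounds [H] by [C + delta * C], hence the slopes by [B']. *)
have [B HB] := Hsup 1.
pose B' := Num.max B (C + delta * C).
have coercive p x : H p x <= C + delta * C -> `|p| <= B'.
  move=> HpC; rewrite le_max; have [//|Bp] := leP `|p| B; apply/orP; right.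
  have [->|p0] := eqVneq p 0.
    by rewrite normr0 addr_ge0// mulr_ge0// ltW.
  have := HB p x Bp; rewrite -(ler_pM2l (_ : 0 < `|p|)) ?normr_gt0//.
  by rewrite mulVKf ?normr_eq0// mulr1 => /le_trans; apply.
have [r r0 Hr] := periodic_unif_continuous B' Hc Hper k0.
have [t t0 gt] := guc _ k0.
have B'0 : 0 <= B'.
  by rewrite le_max addr_ge0 ?orbT// mulr_ge0// ltW.
pose n := Num.min r t; have n0 : 0 < n by rewrite lt_min r0.
(* [a] is so large that slopes bounded by [B'] force [|X i - y| < n]; [b] is so
   small that the slope [e] of the penalization at infinity is below [n]. *)
pose a := (B' + 1) / n; have a0 : 0 < a by rewrite divr_gt0// ltr_wpDl.
pose b := n ^+ 2 / (16 * C + 16).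
have b0 : 0 < b by rewrite divr_gt0 ?exprn_gt0// ltr_wpDl// mulr_ge0.
have [X [y XyP]] := penalized_max z i0 a0 b0 uc wc uC wC.
have a20 : 0 < 2 * a by rewrite pmulr_rgt0.
have b20 : 0 < 2 * b by rewrite pmulr_rgt0.
pose p i := (2 * a) *: (X i - y).
pose e := (2 * b) *: (y - z).
(* With the other variables frozen, [X i] maximizes [u i] minus a quadratic whose slope there is
   [p i]. *)
have ueq i : delta * u i (X i) + H (p i) (X i) - g i (X i) <= 0.
  rewrite /p scalerBr -scaleNr; apply: usub => x.
  pose X' j := if j == i then x else X j.
  have := XyP X' y.
  rewrite (bigD1 i)//= [leRHS](bigD1 i)//=.
  rewrite (eq_bigr (fun j =>
    u j (X j) - a * sqn (X j - y) - w y - b * sqn (y - z))).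
    by rewrite lerD2r /X' eqxx !sqnB_quad; lra.
  by move=> j ji; rewrite /X' (negbTE ji).
(* As a function of the common variable, the penalties are a constant minus [m] times a single
   [quad] with linear part [l]; up to a constant, this [quad] touches [w] from below at [y]. *)
pose l := m^-1 *: \sum_i ((2 * a) *: X i + (2 * b) *: z).
have mV : m * m^-1 = 1 by rewrite divff// gt_eqF.
have ml : m *: l = \sum_i ((2 * a) *: X i + (2 * b) *: z).
  by rewrite scalerA mV scale1r.
clearbody l.
have penalty y' : \sum_i (a * sqn (X i - y') + b * sqn (y' - z)) =
    \sum_i (a * sqn (X i) + b * sqn z) - m * quad (- (a + b)) l y'.
  rewrite quadZ ml.
  have -> : m * - (a + b) = \sum_(i : I) - (a + b).
    by rewrite sumr_const -mulr_natl.
  rewrite -(quad_sum (fun i => (- (a + b), (2 * a) *: X i + (2 * b) *: z))).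
  rewrite -sumrB; apply: eq_bigr => i _ /=.
  rewrite -[a * sqn (X i - y')]opprK -sqn_opp opprB opprK !sqnB_quad.
  rewrite addrACA quadD [RHS]addrC; congr (_ + _).
  rewrite -[RHS]mulN1r quadZ; congr (quad _ _ _); first by rewrite mulN1r opprK.
  by rewrite scaleN1r opprD !scaleNr.
have grad_eq : (2 * - (a + b)) *: y + l = m^-1 *: \sum_i p i - e.
  have -> : \sum_i p i = m *: l - m *: ((2 * a) *: y + (2 * b) *: z).
    rewrite ml scaler_nat -sumr_const -sumrB; apply: eq_bigr => i _.
    by rewrite /p scalerBr opprD addrACA subrr addr0.
  rewrite scalerBr !scalerA mulVf ?gt_eqF// !scale1r /e scalerBr.
  by apply/rowP => j; rewrite !mxE; ring.
have weq : 0 <= delta * w y + H (m^-1 *: \sum_i p i - e) y - G y.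
  rewrite -grad_eq; apply: wsup => y'.
  have := XyP X y'.
  have Phi_split v :
      \sum_i (u i (X i) - a * sqn (X i - v) - w v - b * sqn (v - z)) =
      \sum_i u i (X i) - m * w v -
      \sum_i (a * sqn (X i - v) + b * sqn (v - z)).
    rewrite mulr_natl -sumr_const -!sumrB; apply: eq_bigr => i _; ring.
  rewrite !Phi_split !penalty => ineq.
  rewrite -(ler_pM2l m0) !mulrBr; lra.
(* With all variables at [z] the penalties vanish, so the maximum is at least [s]. This yields [sle]
   and, the maximum being positive, the bound [be] on the outer penalty. *)
have Phi_z := XyP (fun=> z) z.
have Phi_z0 : \sum_i (u i z - a * sqn (z - z) - w z - b * sqn (z - z)) = s.
  rewrite /s mulr_natl -sumr_const -sumrB; apply: eq_bigr => i _.
  have -> : sqn (z - z) = 0.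
    by rewrite subrr /sqn big1// => j _; rewrite mxE expr0n.
  by rewrite !mulr0 !subr0.
rewrite {}Phi_z0 in Phi_z.
have sle : s <= \sum_i (u i (X i) - w y).
  rewrite (le_trans Phi_z)//; apply: ler_sum => i _.
  have : 0 <= a * sqn (X i - y) by rewrite mulr_ge0 ?sqn_ge0// ltW.
  have : 0 <= b * sqn (y - z) by rewrite mulr_ge0 ?sqn_ge0// ltW.
  lra.
have be : b * sqn (y - z) <= 2 * C.
  have : \sum_i (u i (X i) - a * sqn (X i - y) - w y - b * sqn (y - z)) <=
      \sum_(i : I) (2 * C - b * sqn (y - z)).
    apply: ler_sum => i _; have := uC i (X i); have := wC y.
    have : 0 <= a * sqn (X i - y) by rewrite mulr_ge0 ?sqn_ge0// ltW.
    by rewrite !ler_norml => ? /andP[? ?] /andP[? ?]; lra.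
  rewrite sumr_const -[(_ - _) *+ _]mulr_natl.
  move=> /(lt_le_trans (lt_le_trans s0 Phi_z)).
  by rewrite pmulr_rgt0// subr_gt0 => /ltW.
have en : `|e| < n.
  rewrite -ltr_sqr ?nnegrE ?(ltW n0)//.
  rewrite normrZ (gtr0_norm b20) exprMn.
  rewrite (le_lt_trans (_ : _ <= 4 * b * (b * sqn (y - z))))//.
    rewrite (_ : 4 * b * _ = (2 * b) ^+ 2 * sqn (y - z)); last by ring.
    by rewrite ler_wpM2l ?sqr_ge0// sqrnorm_le_sqn.
  rewrite (le_lt_trans (_ : _ <= 4 * b * (2 * C)))//.
    by rewrite ler_wpM2l// mulr_ge0// ltW.
  have -> : 4 * b * (2 * C) = n ^+ 2 * (8 * C / (16 * C + 16)).
    by rewrite /b; ring.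
  by rewrite gtr_pMr ?exprn_gt0// ltr_pdivrMr; lra.
have pB i : `|p i| <= B'.
  apply: (coercive _ (X i)); have := ueq i; have := gC i (X i).
  have : `|delta * u i (X i)| <= delta * C.
    by rewrite normrM gtr0_norm// ler_pM2l.
  rewrite ler_norml => /andP[? ?] ? ?; lra.
have Xy i : `|X i - y| < n.
  rewrite -(ltr_pM2l a20) -[X in X * `|_|](gtr0_norm a20) -normrZ.
  rewrite (le_lt_trans (pB i))//.
  rewrite -mulrA /a divfK ?gt_eqF//; lra.
have pmB : `|m^-1 *: \sum_i p i| <= B'.
  rewrite normrZ gtr0_norm ?invr_gt0// ler_pdivrMl//.
  rewrite (le_trans (ler_norm_sum _ _ _))// mulr_natl -sumr_const.
  exact: ler_sum.
have Hi i : H (p i) y - H (p i) (X i) <= k.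
  apply: ltW; apply: le_lt_trans (ler_norm _) _; rewrite distrC.
  apply: Hr => //.
    by rewrite subrr normr0.
  by rewrite (lt_le_trans (Xy i))// ge_min lexx.
have Hy : H (m^-1 *: \sum_i p i - e) y - H (m^-1 *: \sum_i p i) y <= k.
  apply: ltW; apply: le_lt_trans (ler_norm _) _; rewrite distrC.
  apply: Hr => //.
    by rewrite subKr (lt_le_trans en)// ge_min lexx.
  by rewrite subrr normr0.
have gi i : g i (X i) - g i y <= k.
  apply: ltW; apply: le_lt_trans (ler_norm _) _; apply: gt.
  by rewrite (lt_le_trans (Xy i))// ge_min lexx orbT.
(* Moving each subsolution inequality to [y] costs [2 * k]; with [Hconv], [gG] and [weq], the sum
   gives [delta * s <= 3 * m * k], which is absurd. *)
have : \sum_i (delta * (u i (X i) - w y)) <=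
    \sum_i (2 * k + g i y - H (p i) y - delta * w y).
  apply: ler_sum => i _; have := ueq i; have := Hi i; have := gi i.
  by move=> ? ? ?; lra.
have -> : \sum_i (2 * k + g i y - H (p i) y - delta * w y) =
    m * (2 * k) + \sum_i g i y - \sum_i H (p i) y - m * (delta * w y).
  by rewrite !sumrB big_split /= !sumr_const -[(2 * k) *+ _]mulr_natl
    -[(delta * w y) *+ _]mulr_natl.
rewrite -mulr_sumr.
have := Hconv y p; have := gG y; rewrite -/m => h1 h2 h3.
have h4 : delta * s <= delta * (\sum_i (u i (X i) - w y)) by rewrite ler_pM2l.
have h5 : m * H (m^-1 *: \sum_i p i - e) y <=
    m * (H (m^-1 *: \sum_i p i) y + k).
  by rewrite ler_pM2l// -lerBlDl.
have h6 : 0 <= m * (delta * w y + H (m^-1 *: \sum_i p i - e) y - G y).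
  by rewrite mulr_ge0// ltW.
have h7 : 4 * (m * k) = delta * s by rewrite /k; field; rewrite gt_eqF.
have h8 : 0 < delta * s by rewrite mulr_gt0.
lra.
Qed.

End comparison_principle.

(** * From positive definite Hessians to Jensen's inequality *)

Section convexity.
Context {R : realType} {d : nat}.

Lemma is_derive_line (V : normedModType R) (g : V -> R) (p q : V) (t : R) :
  differentiable g (p + t *: q) ->
  is_derive t (1 : R) (fun s => g (p + s *: q)) ('d g (p + t *: q) q).
Proof.
move=> dg; have : derivable g (p + t *: q) q by exact: diff_derivable.
have quotE : (fun h : R => h^-1 *: ((g \o shift (p + t *: q)) (h *: q) -
      g (p + t *: q))) =
    (fun h : R => h^-1 *: (((fun s => g (p + s *: q)) \o shift t) (h *: 1) -
      g (p + t *: q))).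
  apply/funext => h /=; congr (_ *: (g _ - _)).
  by rewrite /shift /= [h *: 1]mulr1 scalerDl addrCA addrC.
rewrite /derivable quotE => dl; apply: DeriveDef; first exact: dl.
by rewrite -deriveE// /derive quotE.
Qed.

(** Carries the regularity of [H] in the pair [(p, x)] over to [H] as a function of [p] alone; the
    two difference quotients coincide. *)
Lemma diff_partial (V W : normedModType R) (G : V * W -> R) (p : V) (x : W)
    (v : V) :
  differentiable G (p, x) ->
  'D_v (fun p => G (p, x)) p = 'd G (p, x) (v, 0).
Proof.
move=> dG; rewrite -deriveE// /derive.
have -> // : (fun h : R => h^-1 *: (((fun p => G (p, x)) \o shift p) (h *: v) -
      G (p, x))) =
    (fun h : R => h^-1 *: ((G \o shift (p, x)) (h *: (v, 0)) - G (p, x))).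
apply/funext => h /=; congr (_ *: (G _ - _)).
by rewrite /shift /=; congr pair; rewrite [RHS]/= [X in _ = X + _]scaler0 add0r.
Qed.

Lemma differentiable_partial (V W : normedModType R) (G : V * W -> R) (x : W) :
  (forall z, differentiable G z) ->
  forall p, differentiable (fun p => G (p, x)) p.
Proof.
by move=> dG p; apply: (@differentiable_comp _ _ _ _ (fun p => (p, x)) G).
Qed.

Lemma linear_row_sum (L : {linear 'rV[R]_d -> R}) (q : 'rV[R]_d) :
  L q = \sum_i q 0 i * L (delta_mx 0 i).
Proof.
rewrite {1}(row_sum_delta q) linear_sum.
by apply: eq_bigr => i _; rewrite linearZ.
Qed.

(** Two mean value theorems on the segment from [p] to [q]: the first gives the slope at some [c],
    the second compares it with the slope at 0 through the nonnegative second derivative. *)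
Lemma tangent_le (g : 'rV[R]_d -> R) (p q : 'rV[R]_d) :
  (forall x, differentiable g x) ->
  (forall i x, differentiable ('D_(delta_mx 0 i) g) x) ->
  (forall x, posdef_mx (hessian g x)) ->
  g p + 'd g p (q - p) <= g q.
Proof.
move=> dg ddg hg; have [v vE] : exists v, v = q - p by exists (q - p).
rewrite -vE.
pose h (t : R) := g (p + t *: v).
pose h1 (t : R) := 'd g (p + t *: v) v : R.
pose h2 (t : R) : R := \sum_i v 0 i * 'd ('D_(delta_mx 0 i) g) (p + t *: v) v.
have dh t : is_derive t (1 : R) h (h1 t) by exact: is_derive_line.
(* Differentiability is assumed of the partial derivatives, so the slope along the segment is
   expanded in them before being differentiated. *)
have h1E : h1 = \sum_i (fun t => v 0 i *: 'D_(delta_mx 0 i) g (p + t *: v)).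
  apply/funext => t; rewrite fct_sumE /h1 linear_row_sum.
  by apply: eq_bigr => i _; rewrite deriveE.
have dh1 t : is_derive t (1 : R) h1 (h2 t).
  rewrite h1E; apply: is_derive_sum => i; apply: is_deriveZ.
  exact: is_derive_line.
have h2_ge0 t : 0 <= h2 t.
  have [v0|/(hg (p + t *: v))] := eqVneq v 0.
    by rewrite /h2 big1// => i _; rewrite v0 mxE mul0r.
  rewrite -mulmxA mxE => /ltW.
  rewrite (eq_bigr (fun i => v 0 i *
      'd ('D_(delta_mx 0 i) g) (p + t *: v) v)) // => i _.
  rewrite mxE linear_row_sum; congr (_ * _); apply: eq_bigr => j _.
  by rewrite !mxE mulrC deriveE.
have cont (k dk : R -> R) : (forall t, is_derive t (1 : R) k (dk t)) ->
    {within `[0, 1], continuous k}.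
  move=> dk0; apply: derivable_within_continuous => t _.
  exact: (@ex_derive _ _ _ _ _ _ _ (dk0 t)).
have [c /itvP c01 hc] : exists2 c, c \in `]0, 1[%R & h 1 - h 0 = h1 c * (1 - 0).
  by apply: MVT => //; exact: cont dh.
have [e _ he] : exists2 e, e \in `[0, c]%R & h1 c - h1 0 = h2 e * (c - 0).
  apply: MVT_segment => //; first by rewrite c01.
  apply: derivable_within_continuous => t _.
  exact: (@ex_derive _ _ _ _ _ _ _ (dh1 t)).
have : h 0 + h1 0 <= h 1.
  rewrite -lerBrDl hc subr0 mulr1 -subr_ge0 he mulr_ge0//.
  by rewrite subr0 c01.
by rewrite /h /h1 scale0r addr0 scale1r [in leRHS]vE [p + (q - p)]addrC subrK.
Qed.

(** Summing the tangent inequalities at the mean [pm] cancels the linear terms. *)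
Lemma jensen (H : 'rV[R]_d -> 'rV[R]_d -> R) (I : finType) :
  C2 (fun z : 'rV[R]_d * 'rV[R]_d => H z.1 z.2) ->
  (forall p x, posdef_mx (hessian (H^~ x) p)) -> (0 < #|I|)%N ->
  forall x (p : I -> 'rV[R]_d),
    #|I|%:R * H (#|I|%:R^-1 *: \sum_i p i) x <= \sum_i H (p i) x.
Proof.
move=> [[dF _] ddF] Hpos I0 x p; set F := fun z => _ in dF ddF.
have m0 : #|I|%:R != 0 :> R by rewrite pnatr_eq0 -lt0n.
set m := #|I|%:R in m0 *; pose pm := m^-1 *: \sum_i p i.
have dH y : differentiable (H^~ x) y by exact: (differentiable_partial x dF).
have ddH i y : differentiable ('D_(delta_mx 0 i) (H^~ x)) y.
  have [dFi _] := ddF (delta_mx 0 i, 0).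
  rewrite (_ : 'D__ _ = (fun y => 'd F (y, x) (delta_mx 0 i, 0) : R)).
    exact: (differentiable_partial x dFi).
  by apply/funext => y'; exact: (diff_partial (G := F) _ (dF _)).
have Hi i : H pm x + 'd (H^~ x) pm (p i - pm) <= H (p i) x.
  exact: (tangent_le (g := H^~ x)).
have : \sum_i (H pm x + 'd (H^~ x) pm (p i - pm)) <= \sum_i H (p i) x.
  exact: ler_sum.
rewrite big_split /= sumr_const -linear_sum sumrB sumr_const -scaler_nat.
rewrite -[pm *+ _]scaler_nat /pm scalerA divff// scale1r subrr linear0 addr0.
exact.
Qed.

End convexity.

(** * Limits superior of bounded real sequences *)

Section limit_superior.
Context {R : realType}.
Implicit Types (u : nat -> R).

Lemma bounded_fun_itv u (M : R) :
  (forall n, 0 <= u n <= M) -> bounded_fun (u : R^o^nat).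
Proof.
move=> uM; exists M; split; first by rewrite num_real.
move=> x Mx n _ /=; have /andP[u0 un] := uM n.
by rewrite ger0_norm// (le_trans un)// ltW.
Qed.

Lemma limn_sup_itv u (M : R) :
  (forall n, 0 <= u n <= M) -> 0 <= limn_sup u <= M.
Proof.
move=> uM; have bu := bounded_fun_itv uM; rewrite limn_supE//.
have lb := bounded_fun_has_lbound_sups bu.
apply/andP; split.
  apply: lb_le_inf; first by exists (sups u 0), 0%N.
  move=> _ [n _ <-]; have /andP[u0 _] := uM n; rewrite (le_trans u0)//.
  apply: ub_le_sup; last by exists n => /=.
  by exists M => _ [k _ <-]; have /andP[] := uM k.
apply: (@le_trans _ _ (sups u 0)); first by apply: ge_inf => //; exists 0%N.
apply: ge_sup => [|_ [k _ <-]]; last by have /andP[] := uM k.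
by exists (u 0%N), 0%N.
Qed.

(** The limit superior is the infimum of the tail suprema: one of these lies within [e] of it and
    bounds all later terms. *)
Lemma near_le_limn_sup u (M e : R) : (forall n, 0 <= u n <= M) -> 0 < e ->
  \forall n \near \oo, u n <= limn_sup u + e.
Proof.
move=> uM e0; have bu := bounded_fun_itv uM; rewrite limn_supE//.
have lb := bounded_fun_has_lbound_sups bu.
have [_ [n _ <-] un] :
    exists2 x, range (sups u) x & x < inf (range (sups u)) + e.
  by apply: inf_adherent => //; split => //; exists (sups u 0), 0%N.
exists n => // k /= nk; apply: le_trans (ltW un); apply: ub_le_sup.
  by exists M => _ [j _ <-]; have /andP[] := uM j.
by exists k.
Qed.

End limit_superior.

(** * Lattice averages over growing cubes *)

Section lattice_averages.
Context {R : realType} {d : nat}.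
Implicit Types (f : 'rV[R]_d -> R) (x y : 'rV[R]_d).

Definition cube_average f (N : nat) x : R := N%:R ^- d *
  \sum_(k \in [set k : 'rV[int]_d |
                cube 1 (map_mx intr k : 'rV[R]_d) `<=` cube N%:R 0])
    f (x + map_mx intr k).

Lemma hatE f x : hat f x = limn_sup (cube_average f ^~ x).
Proof. by []. Qed.

(* For odd [N] these are exactly the indices of the average, for even [N] there
   are more of them; in both cases there are [N ^ d]. *)
Definition box_point N (phi : {ffun 'I_d -> 'I_N}) : 'rV[int]_d :=
  \row_i ((phi i : nat)%:Z - (N./2)%:Z).

Lemma box_point_inj N : injective (@box_point N).
Proof.
move=> phi psi /rowP pp; apply/ffunP => i; have := pp i.
by rewrite !mxE => /addIr[] /val_inj.
Qed.

(** Only two points of the unit cube are tested: its lower corner, which the half-open cube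
    contains, gives the lower bound, and its centre the upper one. *)
Lemma unit_cube_sub_bounds N (k : 'rV[int]_d) :
  cube 1 (map_mx intr k : 'rV[R]_d) `<=` cube N%:R 0 ->
  forall i, - N%:Z < 2 * k 0 i < N%:Z.
Proof.
move=> kN i.
have /kN/(_ i) : cube 1 (map_mx intr k : 'rV[R]_d) (map_mx intr k).
  by move=> j; rewrite !mxE; lra.
have /kN/(_ i) : cube 1 (map_mx intr k : 'rV[R]_d)
    (\row_j ((k 0 j)%:~R - 1 / 2)).
  by move=> j; rewrite !mxE; lra.
rewrite !mxE => /andP[h1 _] /andP[_ h2].
rewrite -!(ltr_int R) rmorphM rmorphN /=; lra.
Qed.

Lemma unit_cube_sub_box_point N (k : 'rV[int]_d) :
  cube 1 (map_mx intr k : 'rV[R]_d) `<=` cube N%:R 0 ->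
  exists phi : {ffun 'I_d -> 'I_N}, k = box_point phi.
Proof.
move=> /unit_cube_sub_bounds kN.
have kN' i : (`|(k 0 i + (N./2)%:Z)%R|%N < N)%N by have := kN i; lia.
exists [ffun i => Ordinal (kN' i)]; apply/rowP => i; rewrite mxE ffunE /=.
by have := kN i; lia.
Qed.

(** The coordinates run from [-n] to [n], and the outermost unit cubes end exactly at the faces of
    the large one, half its side being [n + 1/2]. *)
Lemma box_point_unit_cube n (phi : {ffun 'I_d -> 'I_(n.*2.+1)}) :
  cube 1 (map_mx intr (box_point phi) : 'rV[R]_d) `<=` cube n.*2.+1%:R 0.
Proof.
move=> y yphi i; have := yphi i; rewrite !mxE.
have : - n%:Z <= (phi i : nat)%:Z - (n.*2.+1./2)%:Z <= n%:Z.
  by have := ltn_ord (phi i); lia.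
rewrite -!(ler_int R) rmorphN /= => /andP[h1 h2] /andP[h3 h4].
have -> : n.*2.+1%:R = 2 * n%:R + 1 :> R by rewrite -addn1 natrD -mul2n natrM.
have nE : n%:Z%:~R = n%:R :> R by [].
by rewrite nE in h1 h2; lra.
Qed.

(** A sum over a fixed finite type, with excluded indices contributing 0, allows termwise comparison
    of averages. *)
Lemma cube_averageE f N x : cube_average f N x = N%:R ^- d *
  \sum_(phi : {ffun 'I_d -> 'I_N})
    if `[< cube 1 (map_mx intr (box_point phi) : 'rV[R]_d) `<=` cube N%:R 0 >]
    then f (x + map_mx intr (box_point phi)) else 0.
Proof.
congr (_ * _); rewrite fsbig_mkcond.
rewrite (fsbigE [seq box_point phi | phi <- index_enum {ffun 'I_d -> 'I_N}])/=.
- rewrite big_map; by apply: congr_big => // phi; rewrite in_setT.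
- by rewrite map_inj_uniq ?index_enum_uniq//; exact: box_point_inj.
- by [].
- move=> k _ kN; rewrite /patch; case: ifPn => //; rewrite inE => /= kc.
  have [phi kphi] := unit_cube_sub_box_point kc.
  by move: kN; rewrite kphi map_f// mem_index_enum.
Qed.

Lemma cube_average_odd f n x : cube_average f n.*2.+1 x = n.*2.+1%:R ^- d *
  \sum_(phi : {ffun 'I_d -> 'I_(n.*2.+1)}) f (x + map_mx intr (box_point phi)).
Proof.
rewrite cube_averageE; congr (_ * _); apply: eq_bigr => phi _.
by rewrite asboolT//; exact: box_point_unit_cube.
Qed.

Lemma sum_weights_le1 N (e : R) : (0 < d)%N -> 0 <= e ->
  N%:R ^- d * \sum_(phi : {ffun 'I_d -> 'I_N}) e <= e.
Proof.
move=> d0 e0; rewrite sumr_const card_ffun !card_ord -[e *+ _]mulr_natl natrX.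
(* For [N = 0] the left side vanishes since [0 < d]; otherwise the [N ^ d] weights add up to 1. *)
rewrite mulrA; case: N => [|N]; first by rewrite expr0n gtn_eqF// mulr0 mul0r.
by rewrite mulVf ?mul1r// expf_neq0// pnatr_eq0.
Qed.

Lemma cube_average_le_add f N x y (e : R) : (0 < d)%N -> 0 <= e ->
  (forall z, f (x + z) <= f (y + z) + e) ->
  cube_average f N x <= cube_average f N y + e.
Proof.
move=> d0 e0 fxy; apply: (@le_trans _ _ (cube_average f N y +
    N%:R ^- d * \sum_(phi : {ffun 'I_d -> 'I_N}) e)); last first.
  by rewrite lerD2l sum_weights_le1.
rewrite !cube_averageE -mulrDr ler_wpM2l ?invr_ge0 ?exprn_ge0//.
rewrite -big_split /=; apply: ler_sum => phi _.
by case: ifP => _; [exact: fxy|rewrite add0r].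
Qed.

Lemma cube_average_itv f (M : R) : (0 < d)%N -> (forall x, 0 <= f x <= M) ->
  forall N x, 0 <= cube_average f N x <= M.
Proof.
move=> d0 fM N x; have /andP[f0 fx] := fM x.
rewrite cube_averageE; apply/andP; split.
  rewrite mulr_ge0 ?invr_ge0 ?exprn_ge0//; apply: sumr_ge0 => phi _.
  by case: ifP => // _; have /andP[] := fM (x + map_mx intr (box_point phi)).
apply: le_trans (sum_weights_le1 N d0 (le_trans f0 fx)).
rewrite ler_wpM2l ?invr_ge0 ?exprn_ge0//; apply: ler_sum => phi _.
case: ifP => _; last exact: le_trans fx.
by have /andP[] := fM (x + map_mx intr (box_point phi)).
Qed.

(** The values of [hat f] lie between 0 and [M], so the [sup] in [sup_norm] is taken over a bounded
    set and is a true upper bound. *)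
Lemma hat_le_sup_norm f (M : R) x : (0 < d)%N -> (forall x, 0 <= f x <= M) ->
  hat f x <= sup_norm (hat f).
Proof.
move=> d0 fM; apply: le_trans (ler_norm _) _.
apply: ub_le_sup; last by exists x.
exists M => _ [y _ <-].
have /andP[h0 hM] := limn_sup_itv ((cube_average_itv d0 fM)^~ y).
by rewrite ger0_norm.
Qed.

Lemma unif_continuous_norm f (e : R) : unif_continuous f -> 0 < e ->
  exists2 r : R, 0 < r & forall x y, `|x - y| < r -> `|f x - f y| < e.
Proof.
move=> /unif_continuousP fc e0; have [r r0 rP] := fc e e0.
exists r => // x y xy; have := rP (x, y).
by rewrite -!ball_normE /=; apply.
Qed.

(* Every translate of [f] is uniformly close to a translate by a bounded vector,
   so a compactness argument over that ball makes the limsup uniform. *)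
Lemma uniform_lattice_average f (M e : R) : (0 < d)%N ->
  (forall x, 0 <= f x <= M) -> unif_continuous f -> almost_periodic f ->
  0 < e ->
  exists (I : finType) (k : I -> 'rV[int]_d), (0 < #|I|)%N /\
    forall x, \sum_i f (x + map_mx intr (k i)) <=
      #|I|%:R * (sup_norm (hat f) + e).
Proof.
(* One third each for the limit superior, for uniform continuity around a centre, and for the almost
   period; [P] contains the first two. *)
move=> d0 fM fc fap e0; pose e3 := e / 3.
have e30 : 0 < e3 by rewrite divr_gt0.
have [L Lap] := fap e3 e30.
have [r r0 rP] := unif_continuous_norm fc e30.
pose P (N : nat) x := cube_average f N x <= sup_norm (hat f) + e3 + e3.
have /compact_near_coveringP cpt := @compact_norm_le R d L.
have [|N0 _ N0P] := cpt nat \oo P _.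
  move=> x _.
  have [N1 _ N1P] := near_le_limn_sup ((cube_average_itv d0 fM)^~ x) e30.
  exists (ball x r, [set N | (N1 <= N)%N]) => /=.
    by split; [exact: nbhsx_ballx|exists N1].
  move=> [y N] /= [xy N1N]; rewrite /P.
  have := cube_average_le_add (f := f) N (x := y) (y := x) d0 (ltW e30).
  move=> /(_ _)/le_trans; apply.
    move=> z; rewrite -lerBlDl (le_trans (ler_norm _))// ltW//; apply: rP.
    by move: xy; rewrite -ball_normE /= distrC opprD addrACA subrr addr0.
  rewrite lerD2r (le_trans (N1P N N1N))// lerD2r -hatE.
  exact: hat_le_sup_norm fM.
(* An odd size beyond [N0] is taken, for which the average runs over all box points. *)
have N0N : (N0 <= N0.*2.+1)%N by lia.
exists {ffun 'I_d -> 'I_(N0.*2.+1)}, (@box_point _); split.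
  by rewrite card_ffun !card_ord expn_gt0.
(* The almost period [t] is within [L] of [x], so [x - t] lies in the compact ball where [P] is
   uniform. *)
move=> x; have [t tx tP] := Lap x.
rewrite card_ffun !card_ord -ler_pdivrMl ?ltr0n ?expn_gt0// natrX.
rewrite -cube_average_odd.
have := cube_average_le_add (f := f) N0.*2.+1 (x := x) (y := x - t)
  d0 (ltW e30).
move=> /(_ _)/le_trans; apply.
  move=> z; rewrite -lerBlDl (le_trans (ler_norm _))//.
  have := tP (x - t + z).
  by rewrite addrAC subrK.
have : P N0.*2.+1 (x - t) by apply: N0P => //=; rewrite distrC.
rewrite /P /e3; lra.
Qed.

End lattice_averages.

(** * Comparison of the periodic corrector with the discounted solutions *)

Lemma bounded_norm_le (R : realType) (T : Type) (g : T -> R) :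
  [bounded g x | x in setT] -> exists C : R, forall x, `|g x| <= C.
Proof.
by move=> [M [_ gM]]; exists (M + 1) => x; apply: gM => //; rewrite ltrDl.
Qed.

Section effective_constants.
Context {R : realType} {d : nat}.
Variables (H : 'rV[R]_d -> 'rV[R]_d -> R) (f : 'rV[R]_d -> R).
Hypothesis H_C2 : C2 (fun z : 'rV[R]_d * 'rV[R]_d => H z.1 z.2).
Hypothesis H_periodic : forall p, Zd_periodic (H p).
Hypothesis H_convex : forall p x, posdef_mx (hessian (H^~ x) p).
Hypothesis H_superlinear : superlinear H.

Let H_cont : continuous (fun z : 'rV[R]_d * 'rV[R]_d => H z.1 z.2).
Proof.
by have [[dH _] _] := H_C2 => z; apply: differentiable_continuous; exact: dH.
Qed.

(** The shift by [C] makes [delta * u <= - Hbar], so [u] is a subsolution with right-hand side 0,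
    below [f]. The index type has one element: no averaging occurs here. *)
Lemma effective_le_discounted (Hbar delta : R) (chi v : 'rV[R]_d -> R) (C : R) :
  (forall x, 0 <= f x) -> 0 < delta ->
  (forall x, `|chi x| <= C) ->
  viscosity_solution (fun _ p x => H p x - Hbar) chi ->
  [bounded v x | x in setT] ->
  viscosity_solution (fun r p x => delta * r + (H p x - f x)) v ->
  forall x, - delta * v x <= Hbar + 2 * (delta * C).
Proof.
move=> f0 delta0 chiC [chic chi_sub _] bv [vc _ v_super] x.
have [Cv vC] := bounded_norm_le bv.
pose u (_ : 'I_1) y := chi y - (C + Hbar / delta).
pose B := Num.max Cv (C + `|C + Hbar / delta|).
have B0 : 0 <= B by rewrite le_max (le_trans (normr_ge0 _) (vC x)).
have deltaV : delta * (Hbar / delta) = Hbar by rewrite mulrC divfK// gt_eqF.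
have chi_bnd y : - (delta * C) <= delta * chi y <= delta * C.
  by rewrite -mulrN !ler_pM2l// -ler_norml.
have : \sum_i u i x <= #|'I_1|%:R * v x.
  apply: (@comparison R d 'I_1 H (fun _ => cst 0) f u v delta B) => //.
  - by rewrite card_ord.
  - by apply: jensen => //; rewrite card_ord.
  - by move=> i y; apply: (@cvgB _ _ _ (nbhs y)); [exact: chic|exact: cvg_cst].
  - by move=> i y; rewrite (le_trans (ler_normB _ _))// le_max lerD2r chiC orbT.
  - by move=> y; rewrite le_max vC.
  - by move=> e e0; exists 1 => // _ y z _; rewrite subrr normr0.
  - move=> i c l y uy.
    have := viscosity_quad_subsolution chi_sub (c := c) (l := l) (x := y).
    move=> /(_ _)/= chi_y.
    have : H ((2 * c) *: y + l) y - Hbar <= 0.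
      by apply: chi_y => z; have := uy z; rewrite /u; lra.
    rewrite /u /cst subr0 mulrBr mulrDr deltaV; have /andP[? ?] := chi_bnd y.
    clear chi_y uy; lra.
  - move=> c l y vy; rewrite -addrA.
    exact: (viscosity_quad_supersolution v_super vy).
  - by move=> y; rewrite big1// card_ord mul1r.
rewrite big_ord1 card_ord mul1r /u -(ler_pM2l delta0) mulrBr mulrDr deltaV.
rewrite mulNr; have /andP[? ?] := chi_bnd x; lra.
Qed.

(** By periodicity of [H], each translate of [v] solves the equation with [f] translated alike. The
    shift in [w] makes [delta * w >= m - Hbar], hence a supersolution with right-hand side [m]. *)
Lemma discounted_le_effective (Hbar delta m : R) (chi v : 'rV[R]_d -> R)
    (C : R) (I : finType) (k : I -> 'rV[int]_d) :
  [bounded f x | x in setT] -> unif_continuous f -> 0 < delta ->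
  (0 < #|I|)%N ->
  (forall x, \sum_i f (x + map_mx intr (k i)) <= #|I|%:R * m) ->
  (forall x, `|chi x| <= C) ->
  viscosity_solution (fun _ p x => H p x - Hbar) chi ->
  [bounded v x | x in setT] ->
  viscosity_solution (fun r p x => delta * r + (H p x - f x)) v ->
  forall x, \sum_i - delta * v (x + map_mx intr (k i)) >=
    #|I|%:R * (Hbar - m - 2 * (delta * C)).
Proof.
move=> bf fc delta0 I0 fm chiC [chic _ chi_super] bv [vc v_sub _] x.
have [Cv vC] := bounded_norm_le bv.
have [Cf fC] := bounded_norm_le bf.
pose w y := chi y + (C + (m - Hbar) / delta).
pose u i y := v (y + map_mx intr (k i)).
pose B := Num.max (Num.max Cv Cf) (C + `|C + (m - Hbar) / delta|).
have deltaV : delta * ((m - Hbar) / delta) = m - Hbar.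
  by rewrite mulrC divfK// gt_eqF.
have chi_bnd y : - (delta * C) <= delta * chi y <= delta * C.
  by rewrite -mulrN !ler_pM2l// -ler_norml.
have cmp : \sum_i u i x <= #|I|%:R * w x.
  apply: (@comparison R d I H (fun i y => f (y + map_mx intr (k i))) (cst m)
    u w delta B) => //.
  - exact: jensen.
  - move=> i y; rewrite -[u i]/(v \o (fun y => y + map_mx intr (k i))).
    apply: continuous_comp.
      by apply: (@cvgD _ _ _ (nbhs y)); [exact: cvg_id|exact: cvg_cst].
    exact: vc.
  - by move=> y; apply: (@cvgD _ _ _ (nbhs y)); [exact: chic|exact: cvg_cst].
  - by move=> i y; rewrite !le_max vC.
  - move=> y; rewrite (le_trans (ler_normD _ _))// le_max lerD2r chiC orbT//.
  - by move=> i y; rewrite (le_trans (ler_norm _))// !le_max fC orbT.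
  - move=> e e0; have [r r0 rP] := unif_continuous_norm fc e0.
    exists r => // i y z yz; apply: rP.
    by rewrite opprD addrACA subrr addr0.
  - move=> i c l y uy.
    have := quad_subsolution_translate (a := map_mx intr (k i))
      (viscosity_quad_subsolution v_sub) uy.
    by rewrite /= H_periodic addrA.
  - move=> c l y wy.
    have := viscosity_quad_supersolution chi_super (c := c) (l := l) (x := y).
    move=> /(_ _) chi_y.
    have : 0 <= H ((2 * c) *: y + l) y - Hbar.
      by apply: chi_y => z; have := wy z; rewrite /w; lra.
    rewrite /w /cst !mulrDr deltaV; have /andP[? ?] := chi_bnd y; lra.
have : delta * \sum_i u i x <= delta * (#|I|%:R * w x) by rewrite ler_pM2l.
move=> cmp_delta; rewrite -mulr_sumr mulNr lerNr; apply: le_trans cmp_delta _.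
rewrite mulrCA -mulrN ler_pM2l ?ltr0n// /w !mulrDr deltaV.
have /andP[? ?] := chi_bnd x; lra.
Qed.

End effective_constants.

(** * Both bounds in the limit of vanishing discount *)

Theorem theorem3p1 (R : realType) (d : nat) (d_gt0 : (0 < d)%N)
  (H : 'rV[R]_d -> 'rV[R]_d -> R) (f : 'rV[R]_d -> R)
  (H_C2 : C2 (fun z : 'rV[R]_d * 'rV[R]_d => H z.1 z.2))
  (H_periodic : forall p, Zd_periodic (H p))
  (H_convex : forall p x, posdef_mx (hessian (H^~ x) p))
  (H_superlinear : superlinear H)
  (f_ge0 : forall x, 0 <= f x)
  (f_bounded : [bounded f x | x in setT])
  (f_unif_continuous : unif_continuous f)
  (f_almost_periodic : almost_periodic f)
  (Hbar Hbarf : R)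
  (Hbar_effective : effective_constant H Hbar)
  (Hbarf_ergodic : ergodic_constant (fun p x => H p x - f x) Hbarf) :
  0 <= Hbar - Hbarf <= sup_norm (hat f).
Proof.
have [chi [chi_per chi_sol]] := Hbar_effective.
have [v [v_sol v_lim]] := Hbarf_ergodic.
have [C chiC] : exists C, forall x, `|chi x| <= C.
  by have [chic _ _] := chi_sol; exact: periodic_bounded.
have C0 : 0 <= C by exact: le_trans (chiC 0).
have small (e : R) : 0 < e -> exists delta, [/\ 0 < delta, delta * C <= e &
    forall x, `|- delta * v delta x - Hbarf| < e].
  (* The divisor is [C + 1] because [C] may be 0. *)
  move=> e0; have Ce0 : 0 < e / (C + 1) by rewrite divr_gt0// ltr_wpDl.
  have [delta [[de d0] dv]] := filter_ex (filterI
    (filterI (nbhs_right_lt Ce0) (nbhs_right_gt (0 : R))) (v_lim e e0)).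
  exists delta; split => //; rewrite (le_trans (_ : _ <= delta * (C + 1)))//.
    by rewrite ler_pM2l// lerDl.
  by rewrite -ler_pdivlMr ?ltr_wpDl// ltW.
(* Each inequality is proved up to [e], spent in quarters: two for [2 * (delta * C)], one for the
   limit in [delta] and, in the upper bound, one for the lattice average. *)
apply/andP; split; apply/ler_addgt0Pr => e e0.
  have e40 : 0 < e / 4 by rewrite divr_gt0.
  have [delta [delta0 deltaC dv]] := small _ e40.
  have [bv sv] := v_sol delta delta0.
  have := effective_le_discounted H_C2 H_periodic H_convex H_superlinear f_ge0
    delta0 chiC chi_sol bv sv 0.
  by have := dv 0; rewrite ltr_norml => /andP[? ?]; lra.
have e40 : 0 < e / 4 by rewrite divr_gt0.
have [M fM] : exists M, forall x, 0 <= f x <= M.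
  have [M fM] := bounded_norm_le f_bounded; exists M => x.
  by rewrite f_ge0 (le_trans (ler_norm _)).
have [I [k [I0 fk]]] :=
  uniform_lattice_average d_gt0 fM f_unif_continuous f_almost_periodic e40.
have [delta [delta0 deltaC dv]] := small _ e40.
have [bv sv] := v_sol delta delta0.
have := discounted_le_effective H_C2 H_periodic H_convex H_superlinear
  f_bounded f_unif_continuous delta0 I0 fk chiC chi_sol bv sv 0.
(* The limit in [delta] is uniform in space, so one [delta] serves all translates. *)
have : \sum_i - delta * v delta (0 + map_mx intr (k i)) <=
    \sum_(i : I) (Hbarf + e / 4).
  apply: ler_sum => i _; rewrite -lerBlDl ltW//.
  by rewrite (le_lt_trans (ler_norm _)).
move=> /[swap] /le_trans /[apply].
rewrite sumr_const -[(Hbarf + _) *+ _]mulr_natl ler_pM2l ?ltr0n//; lra.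
Qed.
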